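(* Let $K$ be a finite subset of the closed unit disc in $\mathbb{C}$. Let $\mu$ and $\nu$ be shift-invariant Borel probability measures on $K^{\mathbb{N}}$, let $\xi$ be a joining of $\mu$ and $\nu$, and let $x\in K^{\mathbb{N}}$ be a point generic for $\mu$. Then there exists a point $y\in K^{\mathbb{N}}$ such that the pair $(x,y)$ is generic for $\xi$ (in particular, $y$ is generic for $\nu$).
   Context: $\mathbb{N}=\{1,2,3,\dots\}$, and $K^{\mathbb{N}}$ (product topology) is equipped with the left shift $(x_n)_{n\ge1}\mapsto(x_{n+1})_{n\ge1}$. A pair $(x,y)$ of elements of $K^{\mathbb{N}}$ is identified with an element of the symbolic space $(K\times K)^{\mathbb{N}}$, also equipped with the left shift. A joining of $\mu$ and $\nu$ is a shift-invariant Borel probability measure on $(K\times K)^{\mathbb{N}}\cong K^{\mathbb{N}}\times K^{\mathbb{N}}$ with marginals $\mu$ (first coordinate) and $\nu$ (second coordinate). For a finite alphabet $\Lambda$, a point $z\in\Lambda^{\mathbb{N}}$ is generic for a shift-invariant probability measure $\rho$ on $\Lambda^{\mathbb{N}}$ if for every $m\ge1$ and every block $B\in\Lambda^m$, $\lim_{n}\frac1n\#\{i\in\{1,\dots,n\}: [z_i,\dots,z_{i+m-1}]=B\}=\rho(B)$, where $\rho(B)$ denotes the measure of the cylinder $\{z\in\Lambda^{\mathbb N}: [z_1,\dots,z_m]=B\}$. *)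

(* Defs.v *)
From HB Require Import structures.
From mathcomp Require Import all_boot all_order all_algebra finmap.
From mathcomp Require Import all_classical all_reals all_analysis.
From mathcomp Require Import complex.

Set Implicit Arguments.
Unset Strict Implicit.
Unset Printing Implicit Defensive.
Import Order.TTheory GRing.Theory Num.Theory.
Import numFieldNormedType.Exports.

Local Open Scope classical_set_scope.
Local Open Scope fset_scope.
Local Open Scope ring_scope.

(* Measurable types of the library are pointed, so alphabets have to be
   nonempty. No generality is lost: the space of sequences over an empty
   alphabet carries no probability measure. *)
#[short(type="alphabetType")]
HB.structure Definition Alphabet := {T of Pointed T & Finite T}.

Definition fset_alphabet (T : choiceType) (K : {fset T}) (K0 : K != fset0) :
  Type := K.

Section fset_alphabet.
Variables (T : choiceType) (K : {fset T}) (K0 : K != fset0).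

HB.instance Definition _ := Finite.copy (fset_alphabet K0) K.

HB.instance Definition _ := isPointed.Build (fset_alphabet K0)
  [` xchooseP (fset0Pn K K0)].

End fset_alphabet.

HB.instance Definition _ (L1 L2 : alphabetType) :=
  Pointed.on (L1 * L2)%type.

Section symbolic.
Variable L : alphabetType.

(* A finite alphabet is discrete; in particular so is a finite subset of the
   complex plane with its subspace topology. Sequences are numbered from 0: the
   n-th symbol, n >= 1, of a point z is z n.-1. *)
Definition sequences : Type :=
  prod_topology (fun _ : nat => discrete_topology L).

HB.instance Definition _ := Pointed.on sequences.
HB.instance Definition _ := Topological.on sequences.

Definition symbolic : measurableType _ := g_sigma_algebraType (@open sequences).

Definition left_shift (z : symbolic) : symbolic := fun n => z n.+1.

Definition block_at (m : nat) (z : symbolic) (i : nat) : m.-tuple L :=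
  [tuple z (i + j)%N : L | j < m].

Definition cylinder (m : nat) (B : m.-tuple L) : set symbolic :=
  [set z | block_at m z 0 = B].

Definition occurrences (m : nat) (B : m.-tuple L) (z : symbolic) (n : nat) :=
  #|[set i : 'I_n | block_at m z i == B]%SET|.

Variable R : realType.

Definition shift_invariant (rho : probability symbolic R) : Prop :=
  forall A, measurable A -> pushforward rho left_shift A = rho A.

Definition generic (z : symbolic) (rho : probability symbolic R) : Prop :=
  forall (m : nat) (B : m.-tuple L), (1 <= m)%N ->
    ((occurrences B z n)%:R / n%:R : R)%:E @[n --> \oo] --> rho (cylinder B).

End symbolic.

Section joining.
Variables (L : alphabetType) (R : realType).

Definition pair_seq (x y : symbolic L) : symbolic (L * L)%type :=
  fun n => (x n, y n).

Definition fst_seq (z : symbolic (L * L)%type) : symbolic L :=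
  fun n => (z n).1.

Definition snd_seq (z : symbolic (L * L)%type) : symbolic L :=
  fun n => (z n).2.

Definition joining (mu nu : probability (symbolic L) R)
    (xi : probability (symbolic (L * L)%type) R) : Prop :=
  [/\ shift_invariant xi,
      forall A, measurable A -> pushforward xi fst_seq A = mu A
    & forall A, measurable A -> pushforward xi snd_seq A = nu A].

End joining.

(* Main.v *)
(* Fix a block length m and a large l. Given an l-word w of x, choose an l-word
   of y over it according to xi conditioned on w. If the l-words of x are read
   at all positions, genericity of x makes the resulting m-blocks of (x, y)
   appear with the frequencies given by xi, up to an error m / l. To pass from
   all positions to a tiling, cut the line into superblocks of length l * l and
   tile each of them from some offset r < l: the mean over r is the mean over
   all positions. Nothing random is needed: in each superblock the offset and
   the words are chosen so that the new error vector has a nonpositive inner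
   product with the sum of the previous ones, which keeps that sum o(n).
   Finally, points y that work for larger and larger m are concatenated along a
   fast growing sequence of switching times. *)
Require Import Defs.
From mathcomp Require Import all_boot all_order all_algebra finmap.
From mathcomp Require Import all_classical all_reals all_analysis.
From mathcomp Require Import complex ring lra zify.
Set Implicit Arguments.
Unset Strict Implicit.
Unset Printing Implicit Defensive.
Import Order.TTheory GRing.Theory Num.Theory.

Local Open Scope fset_scope.
Local Open Scope classical_set_scope.
Local Open Scope ring_scope.

(** * Elementary estimates for finite sums *)

Section finite_sums.
Variable R : realFieldType.
Implicit Type f : nat -> R.

Lemma sum_ord_blocks f (l H : nat) :
  \sum_(q < H * l) f q = \sum_(h < H) \sum_(i < l) f (h * l + i)%N.
Proof.
elim: H => [|H IH]; first by rewrite mul0n !big_ord0.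
by rewrite mulSnr big_split_ord big_ord_recr -IH.
Qed.

Lemma norm_sum_le f (C : R) (n : nat) :
  (forall i, `|f i| <= C) -> `|\sum_(i < n) f i| <= n%:R * C.
Proof.
move=> fC; apply: (le_trans (ler_norm_sum _ _ _)).
apply: (@le_trans _ _ (\sum_(i < n) C)); first exact: ler_sum.
by rewrite sumr_const card_ord mulr_natl.
Qed.

(** A minimiser of [g] on [P] works, because the weights have total mass 1. This replaces every
    random choice in the construction. *)
Lemma exists_le_mean (T : finType) (P : pred T) (w g : T -> R) :
    (forall t, P t -> 0 <= w t) -> \sum_(t | P t) w t = 1 ->
  exists2 t, P t & g t <= \sum_(t' | P t') w t' * g t'.
Proof.
move=> w0 w1.
have [t0 Pt0] : exists t, P t.
  case: (pickP P) => [t Pt|P0]; first by exists t.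
  by move: w1; rewrite big_pred0 // => /eqP; rewrite eq_sym oner_eq0.
have [t Pt tmin] := arg_minP g Pt0.
exists t => //; rewrite -[leLHS]mul1r -w1 mulr_suml.
by apply: ler_sum => t' Pt'; rewrite ler_wpM2l ?w0 ?tmin.
Qed.

(** The positions left out are the [r] before the first tile, the last [m] of each of the [l.-1]
    tiles, and the [l - r] after the last tile: [l + l.-1 * m] in all. *)
Lemma sum_inner_windows f (l m r : nat) :
    (forall i, 0 <= f i <= 1) -> (0 < l)%N -> (m <= l)%N -> (r <= l)%N ->
  `|\sum_(q < l * l) f q
    - \sum_(h < l.-1) \sum_(i < l - m) f (r + h * l + i)%N|
  <= (l * m.+1)%:R.
Proof.
move=> f01 l0 ml rl.
have f1 i : `|f i| <= 1 by have /andP[? ?] := f01 i; rewrite ger0_norm.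
have splitf (g : nat -> R) : \sum_(i < l) g i =
    \sum_(i < l - m) g i + \sum_(i < m) g (l - m + i)%N.
  by rewrite -[in LHS](subnK ml) big_split_ord.
have -> : (l * l = r + (l.-1 * l + (l - r)))%N.
  by rewrite addnCA subnKC // -mulSnr prednK.
rewrite big_split_ord big_split_ord /=.
rewrite (sum_ord_blocks (fun q => f (r + q)%N)).
rewrite [X in _ + (X + _) - _](_ : _ =
  \sum_(h < l.-1) \sum_(i < l - m) f (r + h * l + i)%N
  + \sum_(h < l.-1) \sum_(i < m) f (r + h * l + (l - m + i))%N); last first.
  rewrite -big_split; apply: eq_bigr => h _ /=.
  by rewrite (splitf (fun i => f (r + (h * l + i))%N)); congr (_ + _);
    apply: eq_bigr => i _; rewrite addnA.
set a := \sum_(q < r) _; set b := \sum_(h < _) _; set c := \sum_(h < _) _.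
set e := \sum_(q < l - r) _.
have -> : a + (b + c + e) - b = a + c + e by ring.
have na : `|a| <= r%:R by rewrite (le_trans (norm_sum_le _ f1)) ?mulr1.
have ne : `|e| <= (l - r)%:R.
  rewrite -[leRHS]mulr1.
  exact: (norm_sum_le (f := fun i => f (r + (l.-1 * l + i))%N)).
have nc : `|c| <= (l.-1 * m)%:R.
  rewrite natrM; apply: (norm_sum_le
    (f := fun h => \sum_(i < m) f (r + h * l + (l - m + i))%N)) => h.
  rewrite -[leRHS]mulr1.
  exact: (norm_sum_le (f := fun i => f (r + h * l + (l - m + i))%N)).
apply: (@le_trans _ _ (r + l.-1 * m + (l - r))%N%:R).
  rewrite !natrD (le_trans (ler_normD _ _)) ?lerD //.
  by rewrite (le_trans (ler_normD _ _)) ?lerD.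
by rewrite ler_nat; nia.
Qed.

End finite_sums.

(** * Derandomised choice of a sequence of error vectors *)

Section greedy.
Variables (R : realFieldType) (I : finType) (V : Type).
Variables (d : nat -> V -> I -> R) (C : R).

(* Choosing each step to make a nonpositive inner product with the sum of the
   previous ones, the squared length of the sum grows at most linearly. *)
Lemma greedy_choice :
    (forall j v i, `|d j v i| <= C) ->
    (forall j (a : I -> R), exists v, \sum_i a i * d j v i <= 0) ->
  exists s : nat -> V, forall j i,
    (\sum_(k < j) d k (s k) i) ^+ 2 <= j%:R * (#|I|%:R * C ^+ 2).
Proof.
move=> dC dle0.
have [c cP] : {c : nat * (I -> R) -> V &
    forall ja, \sum_i ja.2 i * d ja.1 (c ja) i <= 0}.
  by apply: (@choice _ _ (fun ja v => \sum_i ja.2 i * d ja.1 v i <= 0))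
    => -[j a]; exact: dle0.
(* The recursion runs on the partial sums [D], since each choice depends on the past only through
   them. *)
pose D := fix D j : I -> R :=
  if j is k.+1 then fun i => D k i + d k (c (k, D k)) i else fun=> 0.
exists (fun k => c (k, D k)) => j i.
have -> : \sum_(k < j) d k (c (nat_of_ord k, D k)) i = D j i.
  by elim: j => [|j IH]; rewrite ?big_ord0 // big_ord_recr /= IH.
(* One coordinate is bounded by the squared Euclidean norm. In the expansion of that norm the cross
   term is nonpositive by the choice of [c], so each step adds at most [#|I| * C ^+ 2]. *)
apply: (@le_trans _ _ (\sum_i' D j i' ^+ 2)).
  by rewrite (bigD1 i) //= lerDl sumr_ge0 // => i' _; exact: sqr_ge0.
elim: j => [|j IH]; first by rewrite big1 ?mul0r // => i' _; rewrite expr0n.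
rewrite /= (eq_bigr (fun i' => D j i' ^+ 2 + (D j i' * d j (c (j, D j)) i') *+ 2
    + d j (c (j, D j)) i' ^+ 2)); last by move=> i' _; rewrite sqrrD.
rewrite !big_split /= -[j.+1%:R]natr1 mulrDl mul1r.
have : \sum_i' D j i' * d j (c (j, D j)) i' <= 0 by exact: (cP (j, D j)).
have : \sum_i' d j (c (j, D j)) i' ^+ 2 <= #|I|%:R * C ^+ 2.
  rewrite mulr_natl -sumr_const; apply: ler_sum => i' _.
  by rewrite -real_normK ?num_real // lerXn2r // ?nnegrE //
    (le_trans _ (dC j (c (j, D j)) i')).
by move: IH; lra.
Qed.

End greedy.

(** * Calculus of error terms of order o(n) *)

Section sublinear.
Variable R : realType.
Implicit Type u v : nat -> R.

Definition sublinear u : Prop :=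
  forall e, 0 < e -> \forall n \near \oo, `|u n| <= e * n%:R.

Lemma sublinearD u v :
  sublinear u -> sublinear v -> sublinear (fun n => u n + v n).
Proof.
move=> su sv e e0; have e20 : 0 < e / 2 by rewrite divr_gt0.
near=> n; rewrite (le_trans (ler_normD _ _)) // [e]splitr mulrDl lerD //.
  by near: n; exact: su.
by near: n; exact: sv.
Unshelve. all: by end_near. Qed.

Lemma sublinearZ (a : R) u : sublinear u -> sublinear (fun n => a * u n).
Proof.
move=> su e e0; have d0 : 0 < e / (`|a| + 1) by rewrite divr_gt0 ?ltr_wpDl.
near=> n; rewrite normrM.
have : `|u n| <= e / (`|a| + 1) * n%:R by near: n; exact: su.
move=> /(ler_wpM2l (normr_ge0 a)) /le_trans; apply.
rewrite mulrA ler_wpM2r // mulrCA ler_piMr ?(ltW e0) //.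
by rewrite ler_pdivrMr ?ltr_wpDl // mul1r lerDl.
Unshelve. all: by end_near. Qed.

Lemma sublinear_cst (a : R) : sublinear (fun=> a).
Proof.
move=> e e0; near=> n; rewrite -ler_pdivrMl // mulrC.
by near: n; exact: nbhs_infty_ger.
Unshelve. all: by end_near. Qed.

Lemma sublinear_sum (T : Type) (r : seq T) (P : pred T) (u : T -> nat -> R) :
    (forall t, P t -> sublinear (u t)) ->
  sublinear (fun n => \sum_(t <- r | P t) u t n).
Proof.
move=> su; elim: r => [|t r IH].
  rewrite (_ : (fun _ => _) = fun=> 0); first exact: sublinear_cst.
  by apply/funext => n; rewrite big_nil.
have [Pt|Pt] := boolP (P t); last first.
  rewrite (_ : (fun _ => _) = fun n => \sum_(t <- r | P t) u t n) //.
  by apply/funext => n; rewrite big_cons (negbTE Pt).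
rewrite (_ : (fun _ => _) = fun n => u t n + \sum_(t <- r | P t) u t n).
  by apply: sublinearD => //; exact: su.
by apply/funext => n; rewrite big_cons Pt.
Qed.

Lemma sublinear_comp (g : nat -> nat) u :
    (forall n, (g n <= n)%N) -> g @ \oo --> \oo ->
  sublinear u -> sublinear (u \o g).
Proof.
move=> gn goo su e e0; near=> n; apply: (@le_trans _ _ (e * (g n)%:R)).
  by near: n; exact: (goo _ (su e e0)).
by rewrite ler_wpM2l ?(ltW e0) // ler_nat.
Unshelve. all: by end_near. Qed.

Lemma sublinear_norm u : sublinear u -> sublinear (fun n => `|u n|).
Proof. by move=> su e /su; apply: filterS => n; rewrite normr_id. Qed.

(** Growth of order at most the square root of [n] is o(n); this is the form in which the greedy
    bound is used. *)
Lemma sublinear_sqr u (K : R) :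
  (forall n, u n ^+ 2 <= n%:R * K) -> sublinear u.
Proof.
move=> uK e e0; near=> n; rewrite -[leRHS]ger0_norm ?mulr_ge0 ?(ltW e0) //.
rewrite -ler_sqr ?nnegrE // !real_normK ?num_real //.
rewrite (le_trans (uK n)) // exprMn [leRHS]mulrC [n%:R ^+ 2]expr2 -mulrA.
rewrite ler_wpM2l // -ler_pdivrMr ?exprn_gt0 //.
by near: n; exact: nbhs_infty_ger.
Unshelve. all: by end_near. Qed.

Lemma cvg_divn (M : nat) : (0 < M)%N -> (fun n => n %/ M)%N @ \oo --> \oo.
Proof.
move=> M0 A [N _ NA]; exists (N * M)%N => // n /= Nn.
by apply: NA => /=; rewrite leq_divRL.
Qed.

Lemma cvg_divnM (M : nat) : (0 < M)%N -> (fun n => n %/ M * M)%N @ \oo --> \oo.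
Proof.
move=> M0 A [N _ NA]; exists (N * M)%N => // n /= Nn; apply: NA => /=.
by rewrite (leq_trans (leq_pmulr N M0)) // leq_mul2r leq_divRL // Nn orbT.
Qed.

End sublinear.

(** * Block frequencies, cylinder probabilities and genericity *)

Section blocks.
Variables (R : realType) (T : alphabetType).
Implicit Types (z : symbolic T) (rho : probability (symbolic T) R).

(** Padding a word with [point] lets [block_at] and [hit] apply to words too; the blocks of interest
    stay inside the word. *)
Definition word_seq (l : nat) (w : l.-tuple T) : symbolic T := nth point w.

Definition hit (m : nat) (B : m.-tuple T) z (i : nat) : R :=
  (block_at m z i == B)%:R.

Definition block_prob rho (m : nat) (B : m.-tuple T) : R :=
  fine (rho (cylinder B)).

Lemma eq_block_at (m : nat) z z' (i i' : nat) :
  (forall t, (t < m)%N -> z (i + t)%N = z' (i' + t)%N :> T) ->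
  block_at m z i = block_at m z' i'.
Proof. by move=> zz'; apply: eq_from_tnth => t; rewrite !tnth_mktuple zz'. Qed.

Lemma word_seq_block_at (l : nat) z (a t : nat) :
  (t < l)%N -> word_seq (block_at l z a) t = z (a + t)%N :> T.
Proof.
move=> tl; rewrite /word_seq.
by rewrite -[t]/(nat_of_ord (Ordinal tl)) -tnth_nth tnth_mktuple.
Qed.

Lemma block_at_word_seq (l : nat) z (k a i : nat) : (i + k <= l)%N ->
  block_at k (word_seq (block_at l z a)) i = block_at k z (a + i).
Proof.
move=> ikl; apply: eq_block_at => t tk; rewrite word_seq_block_at ?addnA //.
by rewrite (leq_trans _ ikl) // ltn_add2l.
Qed.

Lemma hit01 (m : nat) (B : m.-tuple T) z i : 0 <= hit B z i <= 1.
Proof. by rewrite /hit; case: eqP; rewrite lexx ler01. Qed.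

Lemma occurrencesE (m : nat) (B : m.-tuple T) z (n : nat) :
  (occurrences B z n)%:R = \sum_(i < n) hit B z i :> R.
Proof.
by rewrite -natr_sum /occurrences cardsE -sum1_card big_mkcond.
Qed.

Lemma measurable_symbol (i : nat) (a : T) :
  measurable ([set z | z i = a :> T] : set (symbolic T)).
Proof.
apply: sub_sigma_algebra.
have /continuousP coord_open :
    continuous ((fun z => z i) : sequences T -> discrete_topology T).
  exact: (@proj_continuous _ (fun=> discrete_topology T) i).
exact: (coord_open [set a] (discrete_open _)).
Qed.

Lemma measurable_block_at (m i : nat) (B : m.-tuple T) :
  measurable ([set z | block_at m z i = B] : set (symbolic T)).
Proof.
rewrite (_ : mkset _ =
    \bigcap_(j in [set: 'I_m])
      [set z : symbolic T | z (i + j)%N = tnth B j :> T]).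
  by apply: fin_bigcap_measurable => // j _; exact: measurable_symbol.
apply/seteqP; split => [z <- j _|z zB] /=; first by rewrite tnth_mktuple.
by apply: eq_from_tnth => j; rewrite tnth_mktuple zB.
Qed.

Lemma block_probE rho (m : nat) (B : m.-tuple T) :
  (block_prob rho B)%:E = rho (cylinder B).
Proof. by rewrite fineK // fin_num_measure //; exact: measurable_block_at. Qed.

Lemma block_prob01 rho (m : nat) (B : m.-tuple T) : 0 <= block_prob rho B <= 1.
Proof.
rewrite -!lee_fin block_probE measure_ge0 probability_le1 //.
exact: measurable_block_at.
Qed.

Lemma sum_block_prob rho (l : nat) (Q : pred (l.-tuple T)) :
  (\sum_(w | Q w) block_prob rho w)%:E = rho [set z | Q (block_at l z 0)].
Proof.
rewrite (_ : mkset _ = \bigcup_(w in [set` enum Q]) cylinder w); last first.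
  apply/seteqP; split => [z /= Qz|z [w /= wQ zw]]; last first.
    by move: wQ; rewrite zw mem_enum.
  by exists (block_at l z 0) => //=; rewrite mem_enum.
rewrite measure_fin_bigcup //=; last 2 first.
- by move=> w w' _ _ [z [zw zw']]; rewrite -zw -zw'.
- by move=> w _; exact: measurable_block_at.
rewrite -fsbig_seq ?enum_uniq // big_enum -sumEFin.
by apply: eq_bigr => w _; rewrite block_probE.
Qed.

Lemma shift_invariant_block_at rho (m i : nat) (B : m.-tuple T) :
  shift_invariant rho -> rho [set z | block_at m z i = B] = rho (cylinder B).
Proof.
move=> inv; elim: i => // i <-.
by rewrite -(inv _ (measurable_block_at i B)).
Qed.

(** As [i + k <= l], the first [l] symbols decide whether [B] occurs at [i]; invariance then moves
    the occurrence to position 0. *)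
Lemma sum_window_block_prob rho (l k i : nat) (B : k.-tuple T) :
    shift_invariant rho -> (i + k <= l)%N ->
  \sum_(w : l.-tuple T | block_at k (word_seq w) i == B) block_prob rho w
  = block_prob rho B.
Proof.
move=> inv ikl; apply: EFin_inj; rewrite sum_block_prob block_probE.
rewrite -(shift_invariant_block_at i B inv); congr (rho _).
by apply/seteqP; split => z /=; rewrite block_at_word_seq // => /eqP.
Qed.

(** Genericity becomes a statement about additive real errors, to which the o(n) calculus
    applies. *)
Lemma genericP z rho : generic z rho <->
  forall (m : nat) (B : m.-tuple T), (1 <= m)%N ->
    sublinear (fun n => \sum_(i < n) (hit B z i - block_prob rho B)).
Proof.
have E m (B : m.-tuple T) n : (0 < n)%N ->
    `|block_prob rho B - (occurrences B z n)%:R / n%:R| =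
    `|\sum_(i < n) (hit B z i - block_prob rho B)| / n%:R.
  move=> n0; have n0' : (0 : R) < n%:R by rewrite ltr0n.
  rewrite -[X in _ = _ / X](gtr0_norm n0') -normf_div distrC; congr `|_|.
  rewrite sumrB occurrencesE sumr_const card_ord mulrBl.
  by rewrite -[X in _ = _ - X / _]mulr_natl [n%:R * _]mulrC mulfK ?gt_eqF.
split=> gen m B m1.
  move=> e e0; have := gen m B m1; rewrite -block_probE => /fine_cvgP[_].
  move=> /cvgrPdist_le /(_ e e0); apply: filterS => n /= le_e.
  have [->|n0] := posnP n; first by rewrite big_ord0 normr0 mulr0.
  by rewrite -ler_pdivrMr ?ltr0n // -E.
rewrite -block_probE; apply/fine_cvgP; split; first by near=> n.
apply/cvgrPdist_le => e e0; near=> n => /=.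
have n0 : (0 < n)%N by near: n; exact: nbhs_infty_gt.
rewrite E // ler_pdivrMr ?ltr0n //.
by near: n; exact: gen.
Unshelve. all: by end_near. Qed.

End blocks.

(** * Blocks under a symbol-by-symbol map, used for the two coordinate projections *)

Section block_map.
Variables (R : realType) (S T : alphabetType) (f : S -> T).

(** Only the term of the block that [z] actually shows at [i] can be nonzero. *)
Lemma hit_map (k : nat) (B : k.-tuple T) (z : symbolic S) (i : nat) :
  hit R B (fun n => f (z n)) i =
  \sum_(B' : k.-tuple S | map_tuple f B' == B) hit R B' z i.
Proof.
have -> : hit R B (fun n => f (z n)) i = (map_tuple f (block_at k z i) == B)%:R.
  congr (_ == _)%:R; apply: eq_from_tnth => t.
  by rewrite tnth_mktuple tnth_map tnth_mktuple.
rewrite big_mkcond (bigD1 (block_at k z i)) //= big1 => [|B' /negPf B'z].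
  by rewrite addr0 /hit eqxx; case: ifP.
by rewrite /hit [_ == B']eq_sym B'z if_same.
Qed.

Lemma block_prob_map (rho : probability (symbolic S) R)
    (rho' : probability (symbolic T) R) (k : nat) (B : k.-tuple T) :
    (forall A, measurable A ->
       pushforward rho (fun z : symbolic S => (fun n => f (z n)) : symbolic T) A
       = rho' A) ->
  block_prob rho' B =
  \sum_(B' : k.-tuple S | map_tuple f B' == B) block_prob rho B'.
Proof.
move=> push; apply: EFin_inj; rewrite sum_block_prob block_probE.
rewrite -push; last exact: measurable_block_at.
congr (rho _); apply/seteqP; split => z /=.
  move=> <-; apply/eqP.
  by apply: eq_from_tnth => t; rewrite tnth_mktuple tnth_map tnth_mktuple.
move=> /eqP <-; apply: eq_from_tnth => t.
by rewrite tnth_mktuple tnth_map tnth_mktuple.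
Qed.

End block_map.

(** * Lifts of [x] that are correct up to a small frequency error *)

Section approximate_lift.
Variables (R : realType) (L : alphabetType).
Variables (mu : probability (symbolic L) R).
Variables (xi : probability (symbolic (L * L)%type) R).
Hypothesis xi_inv : shift_invariant xi.
Hypothesis xi_fst :
  forall A, measurable A -> pushforward xi (@fst_seq L) A = mu A.
Variable x : symbolic L.
Hypothesis x_generic : generic x mu.

Local Notation fst_word := (map_tuple fst).

(** [kappa] is [xi] conditioned on the first coordinate word. Over a word of [mu]-measure zero, any
    word can carry the mass; the diagonal one is taken. *)
Lemma conditional_kernel (l : nat) : exists kappa : l.-tuple (L * L) -> R,
  [/\ forall z, 0 <= kappa z,
      forall w : l.-tuple L, \sum_(z | fst_word z == w) kappa z = 1
    & forall z, block_prob mu (fst_word z) * kappa z = block_prob xi z].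
Proof.
have muE w : block_prob mu w =
    \sum_(z : l.-tuple (L * L) | fst_word z == w) block_prob xi z.
  exact: block_prob_map.
pose unif w : l.-tuple (L * L) := map_tuple (fun a => (a, a)) w.
have fst_unif w : fst_word (unif w) = w.
  by apply: eq_from_tnth => t; rewrite !tnth_map.
have xi0 (z : l.-tuple (L * L)) : 0 <= block_prob xi z.
  by have /andP[] := block_prob01 xi z.
exists (fun z => let w := fst_word z in
  if block_prob mu w == 0 then (z == unif w)%:R
  else block_prob xi z / block_prob mu w); split => /= [z|w|z].
- by case: ifP => // _; rewrite divr_ge0 // muE sumr_ge0.
- have [w0|w0] := eqVneq (block_prob mu w) 0.
    rewrite (bigD1 (unif w)) /= ?fst_unif // w0 !eqxx big1 ?addr0 //.
    by move=> z /andP[/eqP -> /negPf ->]; rewrite w0 eqxx.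
  rewrite (eq_bigr (fun z => block_prob xi z / block_prob mu w)).
    by rewrite -mulr_suml -muE divff.
  by move=> z /eqP ->; rewrite (negPf w0).
- case: ifP => [/eqP w0|/negbT w0]; last by rewrite mulrC divfK.
  (* Here the nonnegative numbers [block_prob xi z] over a null word sum to zero, so each of them
     vanishes. *)
  rewrite w0 mul0r; apply/esym/eqP.
  by move/eqP: w0; rewrite muE psumr_eq0 // => /allP/(_ z);
    rewrite mem_index_enum eqxx; exact.
Qed.

(** * Patterns of length at most [m] inside words of length [l] *)

Variables (m l : nat).
Hypothesis ml : (m < l)%N.

Let l0 : (0 < l)%N. Proof. exact: leq_ltn_trans ml. Qed.

Let ml_le : (m <= l)%N. Proof. exact: ltnW. Qed.

(** All lengths up to [m] form one finite index set, so that a single greedy choice controls every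
    pattern at once. *)
Definition pattern : finType := {k : 'I_m.+1 & k.-tuple (L * L)}.

Definition pattern_hit (b : pattern) (z : symbolic (L * L)%type) (i : nat) :
    R :=
  hit R (tagged b) z i.

Definition pattern_prob (b : pattern) : R := block_prob xi (tagged b).

(** Starting points stop at [l - m] so that no pattern leaves the word. *)
Definition word_hits (b : pattern) (z : l.-tuple (L * L)) : R :=
  \sum_(i < l - m) pattern_hit b (word_seq z) i.

Lemma pattern_length (b : pattern) : (tag b <= m)%N.
Proof. by case: b => k B /=; rewrite -ltnS. Qed.

Lemma word_hits01 (b : pattern) (z : l.-tuple (L * L)) :
  0 <= word_hits b z <= l%:R.
Proof.
have hitP i : 0 <= pattern_hit b (word_seq z) i <= 1 by exact: hit01.
rewrite sumr_ge0 /= => [|i _]; last by have /andP[] := hitP i.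
apply: (@le_trans _ _ (\sum_(i < l - m) 1)).
  by apply: ler_sum => i _; have /andP[] := hitP i.
by rewrite sumr_const card_ord ler_nat leq_subr.
Qed.

Variable kappa : l.-tuple (L * L) -> R.
Hypothesis kappa_ge0 : forall z, 0 <= kappa z.
Hypothesis kappa1 : forall w : l.-tuple L,
  \sum_(z | fst_word z == w) kappa z = 1.
Hypothesis kappaE :
  forall z, block_prob mu (fst_word z) * kappa z = block_prob xi z.

(** The conditional expectation of [word_hits b] given the first coordinate word [w]. *)
Definition mean_hits (b : pattern) (w : l.-tuple L) : R :=
  \sum_(z | fst_word z == w) kappa z * word_hits b z.

Definition rate (b : pattern) (i : nat) : R :=
  l%:R^-1 * mean_hits b (block_at l x i).

Lemma rate01 (b : pattern) (i : nat) : 0 <= rate b i <= 1.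
Proof.
have lR : (0 : R) < l%:R by rewrite ltr0n.
apply/andP; split.
  rewrite mulr_ge0 ?invr_ge0 ?ler0n // sumr_ge0 // => z _.
  by rewrite mulr_ge0 //; have /andP[] := word_hits01 b z.
rewrite ler_pdivrMl // mulr1 /mean_hits.
have -> : l%:R = \sum_(z | fst_word z == block_at l x i) kappa z * l%:R :> R.
  by rewrite -mulr_suml kappa1 mul1r.
by apply: ler_sum => z _; rewrite ler_wpM2l //; have /andP[] := word_hits01 b z.
Qed.

(** Averaging the conditional expectation gives the expectation under [xi], to which each of the
    [l - m] starting points contributes [pattern_prob b]. *)
Lemma mean_rate (b : pattern) :
  \sum_(w : l.-tuple L) block_prob mu w * mean_hits b w
  = (l - m)%:R * pattern_prob b.
Proof.
transitivity (\sum_(z : l.-tuple (L * L)) block_prob xi z * word_hits b z).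
  rewrite [RHS](partition_big (fun z => fst_word z) xpredT) //=.
  apply: eq_bigr => w _; rewrite mulr_sumr; apply: eq_bigr => z /eqP <-.
  by rewrite mulrA kappaE.
under eq_bigr do rewrite mulr_sumr.
rewrite exchange_big /= (eq_bigr (fun=> pattern_prob b)).
  by rewrite sumr_const card_ord mulr_natl.
move=> i _; rewrite /pattern_prob -(@sum_window_block_prob _ _ _ l _ i) //.
  rewrite [RHS]big_mkcond; apply: eq_bigr => z _.
  by rewrite /pattern_hit /hit; case: eqP => _; rewrite ?mulr1 ?mulr0.
by have := ltn_ord i; have := pattern_length b; lia.
Qed.

(** The sum of the rates is a fixed linear combination of the counts of [l]-words in [x], so
    genericity of [x] gives its mean. *)
Lemma sublinear_rate (b : pattern) : sublinear (fun n =>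
  \sum_(i < n) (rate b i - (l - m)%:R / l%:R * pattern_prob b)).
Proof.
rewrite (_ : (fun _ => _) = fun n => l%:R^-1 * \sum_(w : l.-tuple L)
    mean_hits b w * \sum_(i < n) (hit R w x i - block_prob mu w)).
  apply/sublinearZ/sublinear_sum => w _; apply: sublinearZ.
  by move/genericP: x_generic; apply.
apply/funext => n.
rewrite (eq_bigr (fun w => \sum_(i < n)
  mean_hits b w * (hit R w x i - block_prob mu w))); last first.
  by move=> w _; rewrite mulr_sumr.
rewrite exchange_big /= mulr_sumr; apply: eq_bigr => i _.
rewrite mulrAC -mean_rate [X in _ - X]mulrC -mulrBr; congr (_ * _).
rewrite [RHS](eq_bigr (fun w => mean_hits b w * hit R w x i
  - block_prob mu w * mean_hits b w)).
  rewrite sumrB; congr (_ - _).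
  rewrite [RHS](bigD1 (block_at l x i)) //= big1 => [|w /negPf wx].
    by rewrite addr0 /hit eqxx mulr1.
  by rewrite /hit [_ == w]eq_sym wx mulr0.
by move=> w _; rewrite mulrBr [X in _ - X]mulrC.
Qed.

(** With any offset [r < l], exactly [l.-1] full tiles are sure to fit into a superblock of length
    [l * l]. *)
Definition superblock_hits (b : pattern) (s r : nat) (Y : symbolic L) : R :=
  \sum_(h < l.-1) \sum_(i < l - m)
    pattern_hit b (pair_seq x Y) (s + (r + h * l + i)).

(** For fixed [a] the criterion is one linear functional, so over each [w] some word does not exceed
    its [kappa]-mean. *)
Lemma exists_words (a : pattern -> R) :
  exists Z : l.-tuple L -> l.-tuple (L * L), forall w,
    fst_word (Z w) = w /\
    \sum_b a b * word_hits b (Z w) <= \sum_b a b * mean_hits b w.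
Proof.
suff /choice[Z ZP] : forall w : l.-tuple L, exists z, fst_word z = w /\
    \sum_b a b * word_hits b z <= \sum_b a b * mean_hits b w by exists Z.
move=> w.
have [//|z /eqP zw le_z] := exists_le_mean (P := fun z => fst_word z == w)
  (fun z => \sum_b a b * word_hits b z) _ (kappa1 w).
exists z; split=> //.
suff -> : \sum_b a b * mean_hits b w = \sum_(z' | fst_word z' == w)
  kappa z' * \sum_b a b * word_hits b z' by [].
under [RHS]eq_bigr do rewrite mulr_sumr.
rewrite [RHS]exchange_big /=; apply: eq_bigr => b _; rewrite mulr_sumr.
by apply: eq_bigr => z' _; rewrite mulrCA.
Qed.

(* Averaging over the l possible offsets makes every position the beginning of
   an l-word of x equally often; hence the best offset does not exceed the sum
   of the rates. *)
Lemma exists_superblock (s : nat) (a : pattern -> R) :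
  exists v : 'I_l * symbolic L, \sum_b a b *
    (superblock_hits b s v.1 v.2 - \sum_(i < l.-1 * l) rate b (s + i)) <= 0.
Proof.
have [Z ZP] := exists_words a.
pose phi i := \sum_b a b * mean_hits b (block_at l x i).
have lR : (l%:R : R) != 0 by rewrite pnatr_eq0 -lt0n.
have [||r _ le_r] := @exists_le_mean R 'I_l xpredT (fun=> l%:R^-1)
  (fun r => \sum_(h < l.-1) phi (s + (r + h * l))%N).
- by move=> r _; rewrite invr_ge0 ler0n.
- by rewrite sumr_const card_ord -[X in X = _]mulr_natr mulVf.
(* The quotient by [l] finds the tile containing [p], the remainder the place in it. For [p < s + r]
   the truncated subtraction gives an arbitrary value, which [superblock_hits] never reads. *)
pose Y : symbolic L := fun p => (word_seq
  (Z (block_at l x (s + (r + (p - (s + r)) %/ l * l))))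
  ((p - (s + r)) %% l)%N).2.
exists (r, Y) => /=.
have hitE b (h : nat) (i : 'I_(l - m)) :
    pattern_hit b (pair_seq x Y) (s + (r + h * l + i)) =
    pattern_hit b (word_seq (Z (block_at l x (s + (r + h * l))))) i.
  congr (_ == _)%:R; apply: eq_block_at => t tb.
  have itl : (i + t < l)%N.
    by have := ltn_ord i; have := pattern_length b; lia.
  rewrite /pair_seq /Y.
  have -> : (s + (r + h * l + i) + t - (s + r) = h * l + (i + t))%N by lia.
  rewrite divnMDl // divn_small // addn0 modnMDl modn_small //.
  set w := block_at l x _.
  have -> : x (s + (r + h * l + i) + t)%N = (word_seq (Z w) (i + t)%N).1.
    transitivity (word_seq w (i + t)%N : L).
      by rewrite word_seq_block_at // !addnA.
    rewrite -[in LHS](ZP w).1 /word_seq /=.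
    by rewrite (nth_map point) // size_tuple.
  by rewrite -surjective_pairing.
have -> : \sum_b a b *
    (superblock_hits b s r Y - \sum_(i < l.-1 * l) rate b (s + i)) =
    \sum_(h < l.-1)
      \sum_b a b * word_hits b (Z (block_at l x (s + (r + h * l))))
    - l%:R^-1 * \sum_(i < l.-1 * l) phi (s + i)%N.
  under eq_bigr do rewrite mulrBr.
  rewrite sumrB; congr (_ - _).
    rewrite [RHS]exchange_big; apply: eq_bigr => b _; rewrite -mulr_sumr.
    congr (_ * _); apply: eq_bigr => h _; apply: eq_bigr => i _.
    exact: hitE.
  rewrite [X in _ = _ * X]exchange_big /= mulr_sumr; apply: eq_bigr => b _.
  by rewrite -!mulr_sumr mulrCA.
rewrite subr_le0 (le_trans (ler_sum _ (fun h _ => (ZP _).2))) //.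
rewrite (le_trans le_r) // -mulr_sumr.
(* The pairs of an offset and a tile index enumerate each of the [l.-1 * l] positions once. *)
rewrite (sum_ord_blocks (fun q => phi (s + q)%N)) exchange_big /=.
by under eq_bigr do under eq_bigr do rewrite [(_ + _ * l)%N]addnC.
Qed.


(** Each superblock loses at most [l * m.+1] for positions not counted in the tiles, [l] for the
    rates at its last [l] positions, and [l * m] for the factor [(l - m) / l]. The total
    [2 * l * m.+1], divided by the length [l * l], is the leading constant. *)
Lemma superblock_lift : exists y : symbolic L, forall b : pattern,
  exists2 u : nat -> R, sublinear u & forall n,
    `|\sum_(i < n) (pattern_hit b (pair_seq x y) i - pattern_prob b)|
    <= (2 * m.+1)%:R / l%:R * n%:R + u n.
Proof.
pose M := (l * l)%N.
have M0 : (0 < M)%N by rewrite muln_gt0 l0.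
have hit1 b z i : `|pattern_hit b z i| <= 1.
  by rewrite ger0_norm; have /andP[] := hit01 R (tagged b) z i.
have rate1 b i : `|rate b i| <= 1.
  by rewrite ger0_norm; have /andP[] := rate01 b i.
have [|s sP] := @greedy_choice R pattern _
  (fun j (v : 'I_l * symbolic L) b => superblock_hits b (j * M) v.1 v.2
     - \sum_(i < l.-1 * l) rate b (j * M + i))
  (l.-1%:R * (l - m)%:R + (l.-1 * l)%:R)
  _ (fun j a => exists_superblock (j * M) a).
  move=> j v b; rewrite (le_trans (ler_normB _ _)) // lerD //.
    apply: (norm_sum_le (f := fun h => \sum_(i < l - m)
      pattern_hit b (pair_seq x v.2) (j * M + (v.1 + h * l + i)))) => h.
    rewrite -[leRHS]mulr1; apply: (norm_sum_le (f := fun i =>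
      pattern_hit b (pair_seq x v.2) (j * M + (v.1 + h * l + i)))) => i.
    exact: hit1.
  rewrite -[leRHS]mulr1.
  exact: (norm_sum_le (f := fun i => rate b (j * M + i))).
pose y : symbolic L := fun p => (s (p %/ M)%N).2 p.
exists y => b.
pose c := pattern_hit b (pair_seq x y); pose P := pattern_prob b.
pose S n := \sum_(i < n) (rate b i - (l - m)%:R / l%:R * P).
pose hits k := superblock_hits b (k * M) (s k).1 (s k).2.
pose rates k := \sum_(i < l.-1 * l) rate b (k * M + i).
pose D j := \sum_(k < j) (hits k - rates k).
have subD : sublinear D by apply: sublinear_sqr => j; exact: sP.
have cP_le1 i : `|c i - P| <= 1.
  have := hit01 R (tagged b) (pair_seq x y) i.
  have := block_prob01 xi (tagged b).
  by rewrite -/P -/(c i) /c /pattern_hit /P /pattern_prob ler_norml; lra.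
(* A counted pattern ends inside its own superblock, where [y] agrees with the chosen sequence. *)
have hitsE k : hits k =
    \sum_(h < l.-1) \sum_(i < l - m) c (k * M + ((s k).1 + h * l + i))%N.
  apply: eq_bigr => h _; apply: eq_bigr => i _.
  congr (_ == _)%:R; apply: eq_block_at => t tb.
  rewrite /pair_seq /y; congr (_, (s _).2 _).
  have hM : (h * l + l <= l.-1 * l)%N by rewrite -mulSnr leq_mul2r ltn_ord orbT.
  have lM : (l.-1 * l + l = M)%N by rewrite -mulSnr prednK.
  rewrite -!addnA divnMDl // divn_small ?addn0 //.
  have := ltn_ord i; have := ltn_ord (s k).1; have := pattern_length b.
  lia.
(* The greedy error and the rate error are taken at the end of the last complete superblock; [M]
   pays for the incomplete one. *)
exists (fun n => `|D (n %/ M)%N| + `|S (n %/ M * M)%N| + M%:R).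
  apply: sublinearD; last exact: sublinear_cst.
  apply: sublinearD; apply: sublinear_norm.
    apply: (sublinear_comp (g := fun n => (n %/ M)%N) (u := D)) => //.
      by move=> n; exact: leq_div.
    exact: cvg_divn.
  apply: (sublinear_comp (g := fun n => (n %/ M * M)%N) (u := S)).
  - by move=> n; exact: leq_divM.
  - exact: cvg_divnM.
  - exact: sublinear_rate.
move=> n; set j := (n %/ M)%N.
have lR : (0 : R) < l%:R by rewrite ltr0n.
(* Telescoping from the true counts through the tile counts, the rates in the tiled range and all
   the rates to [P], with the incomplete superblock split off. *)
have -> : \sum_(i < n) (c i - P) =
    \sum_(i < n %% M) (c (j * M + i)%N - P)
    + (\sum_(k < j) (\sum_(q < M) c (k * M + q)%N - hits k)
    + (\sum_(k < j) (rates k - \sum_(q < M) rate b (k * M + q)%N)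
    + (D j + (S (j * M)%N - (j * (l * m))%:R * P)))).
  rewrite [in LHS](divn_eq n M) big_split_ord /= -/j addrC; congr (_ + _).
  rewrite /S !sumrB /D sumrB -!sum_ord_blocks !sumr_const !card_ord.
  rewrite -[P *+ (j * M)]mulr_natr -[(_ * P) *+ _]mulr_natr !natrM natrB //.
  by field; rewrite gt_eqF.
have term1 : `|\sum_(i < n %% M) (c (j * M + i)%N - P)| <= M%:R.
  apply: (@le_trans _ _ (n %% M)%:R); last by rewrite ler_nat ltnW ?ltn_pmod.
  rewrite -[leRHS]mulr1.
  exact: (norm_sum_le (f := fun i => c (j * M + i)%N - P)).
have term2 : `|\sum_(k < j) (\sum_(q < M) c (k * M + q)%N - hits k)|
    <= j%:R * (l * m.+1)%:R.
  apply: (norm_sum_le (f := fun k => \sum_(q < M) c (k * M + q)%N - hits k)).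
  move=> k; rewrite hitsE.
  apply: (sum_inner_windows (f := fun q => c (k * M + q)%N)) => //.
    by move=> i; exact: hit01.
  exact: ltnW.
have term3 : `|\sum_(k < j) (rates k - \sum_(q < M) rate b (k * M + q)%N)|
    <= j%:R * l%:R.
  apply: (norm_sum_le
    (f := fun k => rates k - \sum_(q < M) rate b (k * M + q)%N)) => k.
  rewrite /rates; have -> : M = (l.-1 * l + l)%N by rewrite -mulSnr prednK.
  rewrite big_split_ord /= opprD addrA subrr sub0r normrN.
  rewrite -[leRHS]mulr1.
  exact: (norm_sum_le
    (f := fun i => rate b (k * (l.-1 * l + l) + (l.-1 * l + i))%N)).
have term4 : `|(j * (l * m))%:R * P| <= (j * (l * m))%:R.
  have /andP[P0 P1] : 0 <= P <= 1 by exact: block_prob01.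
  by rewrite ger0_norm ?mulr_ge0 // ler_piMr.
have jMn : j%:R * (l%:R * l%:R) <= n%:R :> R.
  by rewrite -!natrM ler_nat leq_divM.
have main : j%:R * (l * m.+1)%:R + j%:R * l%:R + (j * (l * m))%:R
    <= (2 * m.+1)%:R / l%:R * n%:R :> R.
  rewrite [leLHS](_ : _ = (2 * m.+1)%:R / l%:R * (j%:R * (l%:R * l%:R))).
    by rewrite ler_wpM2l // divr_ge0 // ler0n.
  by rewrite !natrM -[m.+1]addn1 natrD; field; rewrite gt_eqF.
apply: (@le_trans _ _ (M%:R + (j%:R * (l * m.+1)%:R + (j%:R * l%:R
  + (`|D j| + (`|S (j * M)%N| + (j * (l * m))%:R)))))); last by move: main; lra.
do 4 rewrite (le_trans (ler_normD _ _)) // lerD //.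
by rewrite (le_trans (ler_normB _ _)) // lerD.
Qed.

End approximate_lift.

(** * From approximate lifts to a generic one *)

Section lift.
Variables (R : realType) (L : alphabetType).
Variables (mu : probability (symbolic L) R).
Variables (xi : probability (symbolic (L * L)%type) R).
Variable x : symbolic L.

Definition lift_dev (k : nat) (B : k.-tuple (L * L)) (y : symbolic L)
    (n : nat) : R :=
  \sum_(i < n) (hit R B (pair_seq x y) i - block_prob xi B).

Lemma approximate_lift (m : nat) (e : R) :
    shift_invariant xi ->
    (forall A, measurable A -> pushforward xi (@fst_seq L) A = mu A) ->
    generic x mu -> 0 < e ->
  exists y : symbolic L, \forall n \near \oo,
    forall (k : nat) (B : k.-tuple (L * L)), (k <= m)%N ->
    `|lift_dev B y n| <= e * n%:R.
Proof.
move=> xi_inv xi_fst x_generic e0; have e20 : 0 < e / 2 by rewrite divr_gt0.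
have [l ml le_l] : exists2 l, (m < l)%N & (2 * m.+1)%:R <= e / 2 * l%:R.
  near \oo => l; exists l; first by near: l; exact: nbhs_infty_gt.
  by rewrite -ler_pdivrMl // mulrC; near: l; exact: nbhs_infty_ger.
have [kappa [kappa0 kappa1 kappaE]] := conditional_kernel xi_fst l.
have [y yP] := superblock_lift xi_inv x_generic ml kappa0 kappa1 kappaE.
exists y; suff : \forall n \near \oo, forall b : pattern L m,
    `|lift_dev (tagged b) y n| <= e * n%:R.
  apply: filterS => n le_n k B km.
  exact: (le_n (Tagged (fun k : 'I_m.+1 => k.-tuple (L * L)%type)
    (B : (Ordinal (km : (k < m.+1)%N)).-tuple _))).
(* There are finitely many patterns, so one threshold for [n] serves all of them. *)
apply: filter_forall => b; have [u su le_u] := yP b.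
near=> n; rewrite (le_trans (le_u n)) // [e]splitr mulrDl lerD //.
  rewrite ler_wpM2r // ler_pdivrMr ?ltr0n //.
  exact: (leq_ltn_trans _ ml).
rewrite (le_trans (ler_norm _)) //.
by near: n; exact: su.
Unshelve. all: by end_near. Qed.

(** Beyond [a] only positions from [b] on contribute; truncated subtraction makes the bound 0 when
    [n <= b]. *)
Lemma norm_sum_tail_le (g : nat -> R) (a b n : nat) :
    (forall p, (a <= p < b)%N -> g p = 0) -> (forall p, `|g p| <= 1) ->
    (a <= n)%N ->
  `|\sum_(p < n) g p - \sum_(p < a) g p| <= (n - b)%:R.
Proof.
move=> g0 g1; elim: n => [|n IH].
  by rewrite leqn0 => /eqP ->; rewrite subrr normr0.
rewrite leq_eqVlt => /orP[/eqP <-|an]; first by rewrite subrr normr0.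
rewrite big_ord_recr /= addrAC; have [nb|bn] := ltnP n b.
  by rewrite g0 ?nb ?andbT // addr0 (le_trans (IH an)) // ler_nat leq_sub2r.
rewrite subSn // -natr1 (le_trans (ler_normD _ _)) // lerD //.
exact: IH.
Qed.

Lemma norm_lift_dev_le (k : nat) (B : k.-tuple (L * L)) y (n : nat) :
  `|lift_dev B y n| <= n%:R.
Proof.
rewrite -[leRHS]mulr1; apply: (norm_sum_le
  (f := fun i => hit R B (pair_seq x y) i - block_prob xi B)) => i.
have := hit01 R B (pair_seq x y) i; have := block_prob01 xi B.
by rewrite ler_norml; lra.
Qed.

(* Concatenation changes only the occurrences that straddle the point b where
   y stops following y'. *)
Lemma lift_dev_segment (k : nat) (B : k.-tuple (L * L)) (y y' : symbolic L)
    (a b n : nat) :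
    (forall p, (a <= p < b)%N -> y p = y' p :> L) -> (a <= n <= b)%N ->
  `|lift_dev B y n| <=
    `|lift_dev B y a| + `|lift_dev B y' a| + `|lift_dev B y' n| + k%:R.
Proof.
move=> yy' /andP[an nb].
pose g p : R := hit R B (pair_seq x y) p - hit R B (pair_seq x y') p.
have gE n' : \sum_(p < n') g p = lift_dev B y n' - lift_dev B y' n'.
  by rewrite -sumrB; apply: eq_bigr => p _; rewrite /g; ring.
have : `|\sum_(p < n) g p - \sum_(p < a) g p| <= (n - (b - k))%:R.
  apply: norm_sum_tail_le => // [p /andP[ap pb]|p].
    rewrite /g /hit; suff -> : block_at k (pair_seq x y) p =
      block_at k (pair_seq x y') p by rewrite subrr.
    by apply: eq_block_at => t tk; rewrite /pair_seq yy' //; lia.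
  have := hit01 R B (pair_seq x y) p; have := hit01 R B (pair_seq x y') p.
  by rewrite /g ler_norml; lra.
have : (n - (b - k))%:R <= k%:R :> R by rewrite ler_nat; lia.
rewrite !gE !ler_norml; set u := lift_dev B y n; set v := lift_dev B y a.
set u' := lift_dev B y' n; set v' := lift_dev B y' a => h1 h2.
have := ler_norm v; have := ler_norm (- v); rewrite normrN.
have := ler_norm u'; have := ler_norm (- u'); rewrite normrN.
have := ler_norm v'; have := ler_norm (- v'); rewrite normrN.
lra.
Qed.

(** [st p] is the index of the interval containing [p]; strict growth of [N] makes the intervals
    cover all positions without overlap. *)
Lemma nat_partition (N : nat -> nat) :
    N 0%N = 0%N -> (forall k, (N k < N k.+1)%N) ->
  exists st : nat -> nat, forall p k, (N k <= p < N k.+1)%N = (st p == k).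
Proof.
move=> N0 NS.
have /choice[st stP] : forall p, exists k, (N k <= p < N k.+1)%N.
  elim=> [|p [k /andP[kp pk]]].
    by exists 0%N; rewrite N0 (leq_ltn_trans _ (NS _)).
  have [pk1|pk1] := ltnP p.+1 (N k.+1); first by exists k; rewrite pk1 ltnW.
  have e : p.+1 = N k.+1 by apply/eqP; rewrite eqn_leq pk.
  by exists k.+1; rewrite e leqnn NS.
have Nmono i j : (i <= j)%N -> (N i <= N j)%N.
  by apply: (homo_leq leqnn leq_trans) => k; rewrite ltnW.
exists st => p k; apply/idP/eqP => [/andP[kp pk]|<- //].
have /andP[sp ps] := stP p.
apply/eqP; rewrite eqn_leq; apply/andP; split; rewrite leqNgt; apply/negP.
  by move=> /Nmono; lia.
by move=> /Nmono; lia.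
Qed.

Lemma diagonal_lift :
    (forall (m : nat) (e : R), 0 < e ->
       exists y : symbolic L, \forall n \near \oo,
         forall (k : nat) (B : k.-tuple (L * L)), (k <= m)%N ->
         `|lift_dev B y n| <= e * n%:R) ->
  exists y : symbolic L, forall (k : nat) (B : k.-tuple (L * L)),
    sublinear (lift_dev B y).
Proof.
move=> approx; pose delta k : R := k.+1%:R^-1.
have delta0 k : 0 < delta k by rewrite invr_gt0.
have /choice[yT yTP] : forall m, exists yT : symbolic L * nat, forall n,
    (yT.2 <= n)%N -> forall (k : nat) (B : k.-tuple (L * L)), (k <= m)%N ->
    `|lift_dev B yT.1 n| <= delta m * n%:R.
  move=> m; have [y [T _ yP]] := approx m _ (delta0 m).
  by exists (y, T) => n Tn k B km; exact: yP.
(* The time of switching to the lift of index [k] lies past its threshold, and past [k * N k'], so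
   that everything before the previous switch has weight at most [delta k']. *)
pose N := fix N k := if k is k'.+1
  then ((yT k).2 + (k * N k').+1)%N else 0%N.
have NS k : (N k < N k.+1)%N by rewrite /= mulSn; lia.
have [st stP] := nat_partition (erefl : N 0%N = 0%N) NS.
have Nmono i j : (i <= j)%N -> (N i <= N j)%N.
  by apply: (homo_leq leqnn leq_trans) => k; rewrite ltnW.
pose y : symbolic L := fun p => (yT (st p)).1 p.
exists y => j B.
have step k n : (0 < k)%N -> (j <= k)%N -> (N k <= n <= N k.+1)%N ->
    `|lift_dev B y n| <= `|lift_dev B y (N k)| + 2 * delta k * n%:R + j%:R.
  move=> k0 jk kn.
  have := @lift_dev_segment _ B y (yT k).1 _ _ _ _ kn.
  have TN : ((yT k).2 <= N k)%N by case: k k0 {jk kn} => //= k _; lia.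
  have /andP[Nn _] := kn.
  have := yTP k n (leq_trans TN Nn) _ B jk; have := yTP k _ TN _ B jk.
  have : delta k * (N k)%:R <= delta k * n%:R.
    by rewrite ler_wpM2l ?(ltW (delta0 k)) // ler_nat.
  move=> h1 h2 h3 h4; rewrite (le_trans (h4 _)) //.
    by move=> p; rewrite stP /y => /eqP ->.
  lra.
(* Going back only two switches keeps errors from accumulating: the two uses of [step] cost
   [2 * delta k] each, and the trivial bound at [N k] costs one more [delta k]. *)
have bound k n : (0 < k)%N -> (j <= k)%N -> (N k.+1 <= n <= N k.+2)%N ->
    `|lift_dev B y n| <= 5 * delta k * n%:R + 2 * j%:R.
  move=> k0 jk kn; have /andP[Nn _] := kn.
  have := step k.+1 n isT (leqW jk) kn.
  have : `|lift_dev B y (N k.+1)| <=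
    `|lift_dev B y (N k)| + 2 * delta k * (N k.+1)%:R + j%:R.
    by apply: step => //; rewrite leqnn ltnW.
  have := norm_lift_dev_le B y (N k).
  have : (N k)%:R <= delta k * (N k.+1)%:R.
    by rewrite ler_pdivlMl // -natrM ler_nat /=; lia.
  have : delta k * (N k.+1)%:R <= delta k * n%:R.
    by rewrite ler_wpM2l ?(ltW (delta0 k)) // ler_nat.
  have : delta k.+1 * n%:R <= delta k * n%:R.
    by rewrite ler_wpM2r // lef_pV2 ?posrE // ler_nat.
  lra.
move=> e e0; have e20 : 0 < e / 2 by rewrite divr_gt0.
near \oo => k0.
have k0_gt0 : (0 < k0)%N by near: k0; exact: nbhs_infty_gt.
have jk0 : (j <= k0)%N by near: k0; exact: nbhs_infty_ge.
have dk0 : 5 * delta k0 <= e / 2.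
  rewrite ler_pdivrMr // -ler_pdivrMl // mulrC.
  rewrite (@le_trans _ _ k0%:R) ?ler_nat //.
  by near: k0; exact: nbhs_infty_ger.
near=> n.
have n_ge : (N k0.+1 <= n)%N by near: n; exact: nbhs_infty_ge.
have jn : 2 * j%:R <= e / 2 * n%:R.
  by rewrite -ler_pdivrMl // mulrC; near: n; exact: nbhs_infty_ger.
have /andP[stn nst] : (N (st n) <= n < N (st n).+1)%N by rewrite stP.
have k0st : (k0.+1 <= st n)%N.
  by rewrite leqNgt; apply/negP => /Nmono; lia.
case: (st n) k0st stn nst => // k k0k kn nk.
have le_n := bound k n (leq_trans k0_gt0 k0k) (leq_trans jk0 k0k).
rewrite (le_trans (le_n _)) ?kn ?(ltnW nk) //.
rewrite [e]splitr [leRHS]mulrDl lerD // ler_wpM2r // (le_trans _ dk0) //.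
by rewrite ler_wpM2l // lef_pV2 ?posrE // ler_nat.
Unshelve. all: by end_near. Qed.

Lemma generic_lift (nu : probability (symbolic L) R) :
    joining mu nu xi -> generic x mu ->
  exists y : symbolic L, generic (pair_seq x y) xi /\ generic y nu.
Proof.
move=> [xi_inv xi_fst xi_snd] x_generic.
have [y yP] := diagonal_lift
  (fun m e => @approximate_lift m e xi_inv xi_fst x_generic).
exists y; split; apply/genericP => m B m1; first exact: yP.
(* Each count in [y] is the finite sum of the counts in the pair sequence over the blocks projecting
   to [B], and the [nu]-probabilities split in the same way. *)
rewrite (_ : (fun _ => _) = fun n =>
  \sum_(B' : m.-tuple (L * L) | map_tuple snd B' == B) lift_dev B' y n).
  by apply: sublinear_sum => B' _; exact: yP.
apply/funext => n; rewrite exchange_big /=; apply: eq_bigr => i _.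
rewrite sumrB (block_prob_map _ xi_snd).
by rewrite -(@hit_map R _ _ snd _ _ (pair_seq x y)).
Qed.

End lift.

Theorem theorem2p10 (R : realType) (K : {fset R[i]}) (K0 : K != fset0)
    (K_disc : forall z : R[i], z \in K -> `|z| <= 1)
    (mu nu : probability (symbolic (fset_alphabet K0)) R)
    (mu_inv : shift_invariant mu) (nu_inv : shift_invariant nu)
    (xi : probability
            (symbolic (fset_alphabet K0 * fset_alphabet K0)%type) R)
    (xi_joining : joining mu nu xi)
    (x : symbolic (fset_alphabet K0)) (x_generic : generic x mu) :
  exists y : symbolic (fset_alphabet K0),
    generic (pair_seq x y) xi /\ generic y nu.
Proof. exact: generic_lift xi_joining x_generic. Qed.
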